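(* Let $n>2$ be an integer and let $G=(2,n,2)=\langle x,y : x^2=y^n=(xy)^2=e\rangle$ be the polyhedral group. Then the Pell-Narayana length of $G$ for the generating pair $(x,y)$ is $$\begin{cases}\dfrac{3n}{2}, & n\equiv 0\pmod 2,\\[4pt] 3n, & n\equiv 1\pmod 2.\end{cases}$$
   Context: For integers $\ell,m,n>1$, the polyhedral group $(\ell,m,n)$ is defined by the presentation $\langle x,y : x^\ell=y^m=(xy)^n=e\rangle$ (equivalently $\langle x,y,z : x^\ell=y^m=z^n=xyz=e\rangle$). For a finite group $G$ generated by a pair $(x,y)$, the Pell-Narayana orbit of $G$ for $(x,y)$ is the sequence $(s_i)_{i\ge 0}$ in $G$ given by $s_0=x$, $s_1=y$, $s_2=y^2$, and $s_i=s_{i-3}(s_{i-1})^2$ for $i\ge 3$. The Pell-Narayana length of $G$ for $(x,y)$ is the period of this orbit, i.e. the least integer $k\ge 1$ such that $s_{i+k}=s_i$ for all $i\ge 0$. *)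

(* Defs.v *)
From mathcomp Require Import all_boot all_fingroup.

Set Implicit Arguments.
Unset Strict Implicit.
Unset Printing Implicit Defensive.

Local Open Scope group_scope.

Inductive generated2 (G : groupType) (x y : G) : G -> Prop :=
  | generated2_1 : generated2 x y 1
  | generated2_l : generated2 x y x
  | generated2_r : generated2 x y y
  | generated2_M g h :
      generated2 x y g -> generated2 x y h -> generated2 x y (g * h)
  | generated2_V g : generated2 x y g -> generated2 x y g^-1.

Definition polyhedral_rel (l m n : nat) (G : groupType) (x y : G) : Prop :=
  [/\ x ^+ l = 1, y ^+ m = 1 & (x * y) ^+ n = 1].

(* G, with the marked pair (x, y), is the group presented by                  *)
(* < x, y : x^l = y^m = (xy)^n = 1 >. The test groups H are arbitrary (not    *)
(* necessarily finite, unlike in the notation G \isog Grp (...), which only   *)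
(* determines the finite quotients), and the generators are part of the data. *)
Record is_polyhedral (l m n : nat) (G : groupType) (x y : G) : Prop :=
  IsPolyhedral {
    polyhedral_relP : polyhedral_rel l m n x y;
    polyhedral_gen : forall g : G, generated2 x y g;
    polyhedral_univ : forall (H : groupType) (a b : H),
      polyhedral_rel l m n a b ->
      exists f : {multiplicative G -> H}, f x = a /\ f y = b
  }.

Fixpoint pell_narayana (G : groupType) (x y : G) (i : nat) : G :=
  match i with
  | 0 => x
  | 1 => y
  | 2 => y ^+ 2
  | (j.+1.+1 as l).+1 =>
      pell_narayana x y j * pell_narayana x y l ^+ 2
  end.

Definition pell_narayana_period (G : groupType) (x y : G) (k : nat) : Prop :=
  (0 < k)%N /\
  forall i, pell_narayana x y (i + k) = pell_narayana x y i.

Definition is_pell_narayana_length (G : groupType) (x y : G) (k : nat) : Prop :=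
  pell_narayana_period x y k /\
  forall k', pell_narayana_period x y k' -> (k <= k')%N.

(* Main.v *)
(** In (2,n,2) the element x inverts y, so (x y^a)^2 = 1 and the orbit is
    s_(3j) = x y^(2j(j+1)), s_(3j+1) = y, s_(3j+2) = y^(2(j+1)). As y has order n
    (x and y map to v |-> -v and v |-> v + 1 on Z/n), 3j is a period iff n divides
    2j; any other period would put x among the powers of y, forcing y^2 = 1. *)
Require Import Defs.
From mathcomp Require Import all_boot all_fingroup.
From mathcomp Require Import all_algebra zify ring.

Set Implicit Arguments.
Unset Strict Implicit.
Unset Printing Implicit Defensive.

Section PellNarayanaOrbit.
Local Open Scope group_scope.
Variables (G : groupType) (x y : G).
Hypotheses (x2 : x ^+ 2 = 1) (xy2 : (x * y) ^+ 2 = 1).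

(** The hypotheses give y x y = x. In x y^a (y x y) y^a the middle factor therefore collapses to x,
    which brings exponent a + 1 down to a. *)
Lemma reflection_sqr a : (x * y ^+ a) ^+ 2 = 1.
Proof.
elim: a => [|a IHa]; first by rewrite expg0 mulg1.
have yxy : y * (x * y) = x.
  by apply: (mulgI x); rewrite mulgA -expg2 xy2 -expg2 x2.
by rewrite expg2 {1}expgSr expgS -!mulgA (mulgA x y) (mulgA y) yxy mulgA -expg2.
Qed.

Lemma pell_narayanaE j :
  [/\ pell_narayana x y (3 * j) = x * y ^+ (2 * j * j.+1),
      pell_narayana x y (3 * j).+1 = y
    & pell_narayana x y (3 * j).+2 = y ^+ (2 * j.+1)].
Proof.
elim: j => [|j [s0 s1 s2]]; first by rewrite muln0 /= mulg1.
have s3 : pell_narayana x y (3 * j).+3 = x * y ^+ (2 * j.+1 * j.+2).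
  rewrite -[LHS]/(pell_narayana x y (3 * j) * pell_narayana x y (3 * j).+2 ^+ 2).
  by rewrite s0 s2 -expgM -mulgA -expgD; congr (_ * _ ^+ _); lia.
have s4 : pell_narayana x y (3 * j).+4 = y.
  rewrite -[LHS]/(pell_narayana x y (3 * j).+1 * pell_narayana x y (3 * j).+3 ^+ 2).
  by rewrite s1 s3 reflection_sqr mulg1.
have -> : (3 * j.+1 = (3 * j).+3)%N by lia.
split=> //.
rewrite -[LHS]/(pell_narayana x y (3 * j).+2 * pell_narayana x y (3 * j).+4 ^+ 2).
by rewrite s2 s4 -expgD; congr (_ ^+ _); lia.
Qed.

(** A power of y commutes with y, so (xy)^2 would equal x^2 y^2 = y^2. *)
Lemma reflection_neq_rotation a : y ^+ 2 != 1 -> x <> y ^+ a.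
Proof.
move=> /eqP y2 xE; apply: y2.
have cxy : commute x y by rewrite xE; apply/commute_sym/commuteX.
by move: xy2; rewrite expgMn // x2 mul1g.
Qed.

Lemma pell_narayana_periodP k :
    y ^+ 2 != 1 -> (0 < k)%N ->
  pell_narayana_period x y k <->
  exists2 j, k = (3 * j)%N & y ^+ (2 * j) = 1.
Proof.
move=> y2 k_gt0; split=> [[_ per]|[j kE yj]]; last first.
  split=> // i; rewrite {}kE (divn_eq i 3) mulnC addnAC -mulnDr.
  have [s0 s1 s2] := pell_narayanaE (i %/ 3 + j).
  have [t0 t1 t2] := pell_narayanaE (i %/ 3).
  have yjM a : y ^+ (2 * j * a) = 1 by rewrite expgM yj expg1n.
  case: (i %% 3) (ltn_pmod i (isT : 0 < 3)%N) => [|[|[|//]]] _.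
  - rewrite !addn0 s0 t0; congr (_ * _).
    (* Shifting the block index by j changes the exponent of y by a multiple of 2j. *)
    have -> : (2 * (i %/ 3 + j) * (i %/ 3 + j).+1 =
               2 * (i %/ 3) * (i %/ 3).+1 + 2 * j * (2 * (i %/ 3) + j).+1)%N.
      by ring.
    by rewrite expgD yjM mulg1.
  - by rewrite !addn1 s1 t1.
  - rewrite !addn2 s2 t2.
    by rewrite -addSn mulnDr expgD yj mulg1.
have [s0 s1 s2] := pell_narayanaE (k %/ 3).
(* Two instances suffice. If 3 divides k, s_(k+2) = s_2 reads y^(2(k/3+1)) = y^2; otherwise s_k =
   s_0 equates a power of y with x. *)
have := per 0%N; have := per 2%N; rewrite add0n {-3}(divn_eq k 3) mulnC add2n.
case: (k %% 3) (ltn_pmod k (isT : 0 < 3)%N) (divn_eq k 3) => [|[|[|//]]] _ kE.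
- rewrite addn0 s2 => sk _; exists (k %/ 3); first by rewrite mulnC {1}kE addn0.
  by apply: (mulgI (y ^+ 2)); rewrite mulg1 -expgD -mulnS.
- by rewrite addn1 s1 => _ xE; case: (@reflection_neq_rotation 1 y2).
- by rewrite addn2 s2 => _ xE; case: (@reflection_neq_rotation _ y2 (esym xE)).
Qed.

End PellNarayanaOrbit.

(* [gmulf1] and [gmulfXn] do not apply here: [{multiplicative G -> H}] does not
   bundle the preservation of 1. *)
Section MultiplicativeGroupMorphism.
Local Open Scope group_scope.
Variables (G H : groupType) (f : {multiplicative G -> H}).

Lemma multiplicative1 : f 1 = 1.
Proof. by apply: (mulgI (f 1)); rewrite -gmulfM !mulg1. Qed.

Lemma multiplicativeX k : {morph f : y / y ^+ k}.
Proof.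
by move=> y; elim: k => [|k IHk]; rewrite ?multiplicative1 // !expgS gmulfM IHk.
Qed.

End MultiplicativeGroupMorphism.

Section DihedralModel.
Import GRing.Theory.
Local Open Scope ring_scope.
Variable n : nat.

Definition Zn_opp : {perm 'Z_n} := perm (@oppr_inj 'Z_n).
Definition Zn_succ : {perm 'Z_n} := perm (@addIr 'Z_n 1).

Lemma Zn_succX k v : (Zn_succ ^+ k)%g v = v + k%:R.
Proof.
elim: k => [|k IHk]; first by rewrite expg0 perm1 addr0.
by rewrite expgSr permM IHk permE -addrA -mulrSr.
Qed.

(** This makes the permutations of Z/n a test group for [polyhedral_univ]. The bound matters: ['Z_n]
    has n elements only for n > 1. *)
Lemma Zn_polyhedral : (1 < n)%N -> polyhedral_rel 2 n 2 Zn_opp Zn_succ.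
Proof.
move=> n_gt1; split; apply/permP=> v.
- by rewrite expg2 permM perm1 !permE opprK.
- by rewrite Zn_succX perm1 pchar_Zp ?addr0.
- by rewrite expg2 !permM perm1 !permE opprD opprK addrNK.
Qed.

End DihedralModel.

(** The relations only bound the order of y from above. For the lower bound, the image of y^k in the
    model sends 0 to k mod n. *)
Lemma polyhedral_expg_eq1 (n : nat) (G : groupType) (x y : G) (k : nat) :
  1 < n -> is_polyhedral 2 n 2 x y -> (y ^+ k == 1)%g = (n %| k).
Proof.
move=> n_gt1 [[_ yn _] _ univ]; apply/eqP/idP=> [yk|/dvdnP[q ->]]; last first.
  by rewrite mulnC expgM yn expg1n.
have [f [_ fy]] := univ _ _ _ (Zn_polyhedral n_gt1).
have /permP/(_ 0%R) : (Zn_succ n ^+ k = 1)%g.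
  by have := multiplicativeX f k y; rewrite yk fy multiplicative1 => <-.
rewrite Zn_succX perm1 GRing.add0r => /(congr1 val).
by rewrite /= val_Zp_nat // => /eqP.
Qed.

Theorem theorem19 (n : nat) (hn : 2 < n) (G : groupType) (x y : G)
    (hG : is_polyhedral 2 n 2 x y) :
  is_pell_narayana_length x y (if odd n then 3 * n else (3 * n) %/ 2).
Proof.
have [x2 _ xy2] := polyhedral_relP hG.
have yX k := polyhedral_expg_eq1 k (ltnW hn) hG.
have y2 : (y ^+ 2 != 1)%g by rewrite yX gtnNdvd.
(* [d] is n / gcd(n, 2), so the j with n dividing 2j are exactly the multiples of [d]. *)
pose d := if odd n then n else n./2.
have -> : (if odd n then 3 * n else (3 * n) %/ 2) = 3 * d.
  by rewrite /d; case: ifP => // n_even; lia.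
have dvd_d j : (n %| 2 * j) = (d %| j).
  rewrite /d; case: ifP => [n_odd|n_even]; first by rewrite Gauss_dvdr ?coprimen2.
  by rewrite -{1}(even_halfK (negbT n_even)) -mul2n dvdn_pmul2l.
have d_gt0 : 0 < d by rewrite /d; case: ifP => _; lia.
split=> [|k per].
  apply/(pell_narayana_periodP x2 xy2 y2); first by rewrite muln_gt0.
  by exists d => //; apply/eqP; rewrite yX dvd_d.
have [k_gt0 _] := per.
have [j kE /eqP] := (pell_narayana_periodP x2 xy2 y2 k_gt0).1 per.
rewrite yX dvd_d => d_dvd; rewrite kE leq_mul2l dvdn_leq //; lia.
Qed.
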